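(* Let $A(m\mid n)$ be the abelian Lie superalgebra of dimension $(m\mid n)$. Then $A(m\mid n)$ is $2$-capable if and only if $m+n\ge 2$.
   Context: Lie superalgebras are over a fixed ground field. $A(m\mid n)$ is the abelian Lie superalgebra with even part of dimension $m$ and odd part of dimension $n$. For a Lie superalgebra $H$, $Z(H)$ is the centre and $Z_2(H)=\{x\in H\mid [x,H]\subseteq Z(H)\}$. A Lie superalgebra $L$ is $2$-capable if there exists a Lie superalgebra $H$ with $L\cong H/Z_2(H)$.
   Formalization: The case m = n = 0 is excluded by assuming m + n ≥ 1: the zero superalgebra A(0|0) is 2-capable (take H = 0), so the stated equivalence fails there. *)

(* Defs.v *)
From HB Require Import structures.
From mathcomp Require Import all_boot all_algebra.
From mathcomp Require Import generic_quotient ring_quotient boolp.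

Set Implicit Arguments.
Unset Strict Implicit.
Unset Printing Implicit Defensive.

Import GRing.Theory.
Local Open Scope ring_scope.
Local Open Scope quotient_scope.

(* Parities are booleans (false = even, true = odd) and add up with (+).
   [super_alt] and [super_cube] follow from [super_skew] and [super_jacobi] when
   2 and 3 are invertible; as usual they are part of the definition over a field
   of arbitrary characteristic. *)
HB.mixin Record isLieSuper (K : fieldType) L of GRing.Lmodule K L := {
  homog : bool -> {pred L};
  homog_submod : forall a, submod_closed (homog a);
  homog_decomp : forall x : L, exists x0 x1 : L,
    [/\ x0 \in homog false, x1 \in homog true & x = x0 + x1];
  homog_direct : forall x : L,
    x \in homog false -> x \in homog true -> x = 0;
  sbracket : L -> L -> L;
  sbracket_linearl : forall y : L, linear (sbracket^~ y);
  sbracket_linearr : forall x : L, linear (sbracket x);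
  sbracket_homog : forall a b (x y : L),
    x \in homog a -> y \in homog b -> sbracket x y \in homog (a (+) b);
  super_skew : forall a b (x y : L), x \in homog a -> y \in homog b ->
    sbracket x y = - ((-1) ^+ (a && b) *: sbracket y x);
  super_jacobi : forall a b (x y z : L), x \in homog a -> y \in homog b ->
    sbracket x (sbracket y z) =
      sbracket (sbracket x y) z + (-1) ^+ (a && b) *: sbracket y (sbracket x z);
  super_alt : forall x : L, x \in homog false -> sbracket x x = 0;
  super_cube : forall x : L, x \in homog true -> sbracket x (sbracket x x) = 0
}.

#[short(type="lieSuperType")]
HB.structure Definition LieSuper (K : fieldType) :=
  {L of isLieSuper K L & GRing.Lmodule K L}.

Arguments sbracket_homog {K L} [a b x y] hx hy : rename.
Arguments super_skew {K L} [a b x y] hx hy : rename.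
Arguments super_jacobi {K L} [a b x y] z hx hy : rename.

Notation "{[ x , y ]}" := (sbracket x y) (at level 0, format "{[ x ,  y ]}").

Definition lieSuper_isom (K : fieldType) (L M : lieSuperType K) : Prop :=
  exists f : {linear L -> M},
    [/\ bijective f,
        forall a x, x \in homog a -> f x \in homog a
      & forall x y, f {[x, y]} = {[f x, f y]}].

Section Basics.
Variables (K : fieldType) (L : lieSuperType K).
Implicit Types (x y z : L) (a b : bool).

Lemma homog0 a : (0 : L) \in homog a.
Proof. by case: (@homog_submod K L a). Qed.

Lemma homogP a (k : K) x y :
  x \in homog a -> y \in homog a -> k *: x + y \in homog a.
Proof. by case: (@homog_submod K L a) => _ h; exact: h. Qed.

Lemma homogD a x y : x \in homog a -> y \in homog a -> x + y \in homog a.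
Proof. by move=> hx hy; rewrite -[x]scale1r; exact: homogP. Qed.

Lemma homogZ a (k : K) x : x \in homog a -> k *: x \in homog a.
Proof. by move=> hx; rewrite -[_ *: _]addr0; apply: homogP => //; exact: homog0. Qed.

Lemma homogN a x : x \in homog a -> - x \in homog a.
Proof. by move=> hx; rewrite -scaleN1r; exact: homogZ. Qed.

Lemma sbracketDl x1 x2 y : {[x1 + x2, y]} = {[x1, y]} + {[x2, y]}.
Proof.
by have := @sbracket_linearl K L y 1 x1 x2; rewrite /= !scale1r.
Qed.

Lemma sbracketDr x y1 y2 : {[x, y1 + y2]} = {[x, y1]} + {[x, y2]}.
Proof.
by have := @sbracket_linearr K L x 1 y1 y2; rewrite /= !scale1r.
Qed.

Lemma sbracket0l y : {[0, y]} = 0.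
Proof. by apply: (addIr {[0, y]}); rewrite -sbracketDl !add0r. Qed.

Lemma sbracket0r x : {[x, 0]} = 0.
Proof. by apply: (addIr {[x, 0]}); rewrite -sbracketDr !add0r. Qed.

Lemma sbracketZl (k : K) x y : {[k *: x, y]} = k *: {[x, y]}.
Proof.
by have := @sbracket_linearl K L y k x 0; rewrite /= sbracket0l !addr0.
Qed.

Lemma sbracketZr (k : K) x y : {[x, k *: y]} = k *: {[x, y]}.
Proof.
by have := @sbracket_linearr K L x k y 0; rewrite /= sbracket0r !addr0.
Qed.

Lemma sbracketBl x1 x2 y : {[x1 - x2, y]} = {[x1, y]} - {[x2, y]}.
Proof. by rewrite sbracketDl -scaleN1r sbracketZl scaleN1r. Qed.

Lemma sbracketBr x y1 y2 : {[x, y1 - y2]} = {[x, y1]} - {[x, y2]}.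
Proof. by rewrite sbracketDr -scaleN1r sbracketZr scaleN1r. Qed.

Lemma homog_add_eq0 x0 x1 :
  x0 \in homog false -> x1 \in homog true -> x0 + x1 = 0 -> x0 = 0 /\ x1 = 0.
Proof.
move=> h0 h1 /eqP; rewrite addr_eq0 => /eqP e.
have z0 : x0 = 0 by apply: homog_direct => //; rewrite e; exact: homogN.
by split=> //; apply/eqP; rewrite -oppr_eq0 -e z0.
Qed.

End Basics.

Record gideal (K : fieldType) (L : lieSuperType K) := GIdeal {
  gideal_mem :> {pred L};
  gideal_submod : submod_closed gideal_mem;
  gideal_absorb : forall x y : L, x \in gideal_mem ->
    {[x, y]} \in gideal_mem /\ {[y, x]} \in gideal_mem;
  gideal_graded : forall x0 x1 : L, x0 \in homog false -> x1 \in homog true ->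
    x0 + x1 \in gideal_mem -> x0 \in gideal_mem /\ x1 \in gideal_mem
}.

Section Quotient.
Variables (K : fieldType) (L : lieSuperType K) (I : gideal L).
Implicit Types (x y z : L) (a b : bool).

Let gideal_subsemimod : subsemimod_closed (gideal_mem I).
Proof.
have [I0 IP] := gideal_submod I; split; first split=> //.
  by move=> x y Ix Iy; rewrite -[x]scale1r; exact: IP.
by move=> k x Ix; rewrite -[_ *: _]addr0; exact: IP.
Qed.

HB.instance Definition _ :=
  GRing.isSubmodClosed.Build K L (gideal_mem I) gideal_subsemimod.

Definition lieQuot : Type := Quotient.quot (gideal_mem I : zmodClosed L).

HB.instance Definition _ := GRing.Zmodule.on lieQuot.

Definition lieProj : L -> lieQuot :=
  \pi_(Quotient.quot (gideal_mem I : zmodClosed L)).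

Definition lieRepr (u : lieQuot) : L :=
  repr (u : Quotient.quot (gideal_mem I : zmodClosed L)).

Lemma lieReprK : cancel lieRepr lieProj.
Proof. by move=> u; rewrite /lieProj /lieRepr reprK. Qed.

Lemma lieProj_eq x y : (lieProj x == lieProj y) = (x - y \in gideal_mem I).
Proof. by rewrite Quotient.idealrBE. Qed.

Lemma lieProjP x y : reflect (lieProj x = lieProj y) (x - y \in gideal_mem I).
Proof. by rewrite -lieProj_eq; exact: eqP. Qed.

Lemma lieProjD x y : lieProj (x + y) = lieProj x + lieProj y.
Proof. exact: (Quotient.pi_add (gideal_mem I : zmodClosed L) x y). Qed.

Lemma lieProjN x : lieProj (- x) = - lieProj x.
Proof. exact: (Quotient.pi_opp (gideal_mem I : zmodClosed L) x). Qed.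

Lemma lieProj0 : lieProj 0 = 0.
Proof. by rewrite -[0 in LHS](subrr 0) lieProjD lieProjN subrr. Qed.

Lemma lieProj_eq0 x : (lieProj x == 0) = (x \in gideal_mem I).
Proof. by rewrite -lieProj0 lieProj_eq subr0. Qed.

Lemma lieRepr_proj x : lieRepr (lieProj x) - x \in gideal_mem I.
Proof. by rewrite -lieProj_eq lieReprK. Qed.

Definition quot_scale (k : K) (u : lieQuot) : lieQuot :=
  lieProj (k *: lieRepr u).

Lemma quot_scaleE k x : quot_scale k (lieProj x) = lieProj (k *: x).
Proof.
apply/lieProjP; rewrite -scalerBr.
exact: rpredZ (lieRepr_proj x).
Qed.

Fact quot_scaleA k l u :
  quot_scale k (quot_scale l u) = quot_scale (k * l) u.
Proof. by rewrite -[u]lieReprK !quot_scaleE scalerA. Qed.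

Fact quot_scale1 : left_id 1 quot_scale.
Proof. by move=> u; rewrite -[u]lieReprK quot_scaleE scale1r. Qed.

Fact quot_scaleDr : right_distributive quot_scale +%R.
Proof.
move=> k u v; rewrite -[u]lieReprK -[v]lieReprK.
by rewrite -lieProjD !quot_scaleE scalerDr lieProjD.
Qed.

Fact quot_scaleDl u : {morph quot_scale^~ u : k l / k + l}.
Proof.
by move=> k l; rewrite -[u]lieReprK !quot_scaleE scalerDl lieProjD.
Qed.

HB.instance Definition _ := GRing.Zmodule_isLmodule.Build K lieQuot
  quot_scaleA quot_scale1 quot_scaleDr quot_scaleDl.

Lemma lieProjZ k x : lieProj (k *: x) = k *: lieProj x.
Proof. by rewrite -quot_scaleE. Qed.

Definition quot_homog a : {pred lieQuot} :=
  [pred u | `[< exists2 x, x \in homog a & u = lieProj x >]].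

Definition quot_bracket (u v : lieQuot) : lieQuot :=
  lieProj {[lieRepr u, lieRepr v]}.

Lemma quot_homogP a u :
  reflect (exists2 x, x \in homog a & u = lieProj x) (u \in quot_homog a).
Proof. by rewrite inE; exact: asboolP. Qed.

Lemma quot_bracketE x y :
  quot_bracket (lieProj x) (lieProj y) = lieProj {[x, y]}.
Proof.
apply/lieProjP; set x' := lieRepr _; set y' := lieRepr _.
have -> : {[x', y']} - {[x, y]} = {[x' - x, y']} + {[x, y' - y]}.
  by rewrite sbracketBl sbracketBr addrA subrK.
apply: rpredD.
  by have [] := gideal_absorb y' (lieRepr_proj x).
by have [] := gideal_absorb x (lieRepr_proj y).
Qed.

Fact quot_homog_submod a : submod_closed (quot_homog a).
Proof.
split.
  by apply/quot_homogP; exists 0; [exact: homog0 | rewrite lieProj0].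
move=> k u v /quot_homogP[x hx ->] /quot_homogP[y hy ->].
apply/quot_homogP; exists (k *: x + y); first exact: homogP.
by rewrite lieProjD lieProjZ.
Qed.

Fact quot_homog_decomp (u : lieQuot) : exists u0 u1 : lieQuot,
  [/\ u0 \in quot_homog false, u1 \in quot_homog true & u = u0 + u1].
Proof.
have [x0 [x1 [h0 h1 e]]] := homog_decomp (lieRepr u).
exists (lieProj x0), (lieProj x1); split.
- by apply/quot_homogP; exists x0.
- by apply/quot_homogP; exists x1.
- by rewrite -lieProjD -e lieReprK.
Qed.

Fact quot_homog_direct (u : lieQuot) :
  u \in quot_homog false -> u \in quot_homog true -> u = 0.
Proof.
move=> /quot_homogP[x0 h0 ->] /quot_homogP[x1 h1] /eqP.
rewrite lieProj_eq => hI; apply/eqP; rewrite lieProj_eq0.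
by have [] := gideal_graded h0 (homogN h1) hI.
Qed.

Fact quot_bracket_linearl (v : lieQuot) : linear (quot_bracket^~ v).
Proof.
move=> k u u'; rewrite -[u]lieReprK -[u']lieReprK -[v]lieReprK.
rewrite -lieProjZ -lieProjD !quot_bracketE sbracketDl sbracketZl.
by rewrite lieProjD lieProjZ.
Qed.

Fact quot_bracket_linearr (u : lieQuot) : linear (quot_bracket u).
Proof.
move=> k v v'; rewrite -[u]lieReprK -[v]lieReprK -[v']lieReprK.
rewrite -lieProjZ -lieProjD !quot_bracketE sbracketDr sbracketZr.
by rewrite lieProjD lieProjZ.
Qed.

Fact quot_bracket_homog a b (u v : lieQuot) :
  u \in quot_homog a -> v \in quot_homog b ->
  quot_bracket u v \in quot_homog (a (+) b).
Proof.
move=> /quot_homogP[x hx ->] /quot_homogP[y hy ->].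
apply/quot_homogP; exists {[x, y]}; last by rewrite quot_bracketE.
exact: sbracket_homog.
Qed.

Fact quot_super_skew a b (u v : lieQuot) :
  u \in quot_homog a -> v \in quot_homog b ->
  quot_bracket u v = - ((-1) ^+ (a && b) *: quot_bracket v u).
Proof.
move=> /quot_homogP[x hx ->] /quot_homogP[y hy ->].
by rewrite !quot_bracketE -lieProjZ -lieProjN -(super_skew hx hy).
Qed.

Fact quot_super_jacobi a b (u v w : lieQuot) :
  u \in quot_homog a -> v \in quot_homog b ->
  quot_bracket u (quot_bracket v w) = quot_bracket (quot_bracket u v) w
    + (-1) ^+ (a && b) *: quot_bracket v (quot_bracket u w).
Proof.
move=> /quot_homogP[x hx ->] /quot_homogP[y hy ->]; rewrite -[w]lieReprK.
by rewrite !quot_bracketE (super_jacobi _ hx hy) lieProjD lieProjZ.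
Qed.

Fact quot_super_alt (u : lieQuot) :
  u \in quot_homog false -> quot_bracket u u = 0.
Proof.
by move=> /quot_homogP[x hx ->]; rewrite quot_bracketE super_alt ?lieProj0.
Qed.

Fact quot_super_cube (u : lieQuot) :
  u \in quot_homog true -> quot_bracket u (quot_bracket u u) = 0.
Proof.
by move=> /quot_homogP[x hx ->]; rewrite !quot_bracketE super_cube ?lieProj0.
Qed.

HB.instance Definition _ := isLieSuper.Build K lieQuot
  quot_homog_submod quot_homog_decomp quot_homog_direct
  quot_bracket_linearl quot_bracket_linearr quot_bracket_homog
  quot_super_skew quot_super_jacobi quot_super_alt quot_super_cube.

End Quotient.

Section Centre.
Variables (K : fieldType) (H : lieSuperType K).
Implicit Types x y h : H.

Definition centre : {pred H} := [pred x | `[< forall h, {[x, h]} = 0 >]].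

Definition centre2 : {pred H} :=
  [pred x | `[< forall h, {[x, h]} \in centre >]].

Lemma centreP x : reflect (forall h, {[x, h]} = 0) (x \in centre).
Proof. by rewrite inE; exact: asboolP. Qed.

Lemma centre2P x : reflect (forall h, {[x, h]} \in centre) (x \in centre2).
Proof. by rewrite inE; exact: asboolP. Qed.

Lemma centre_submod : submod_closed centre.
Proof.
split; first by apply/centreP => h; rewrite sbracket0l.
move=> k x y /centreP hx /centreP hy; apply/centreP => h.
by rewrite sbracketDl sbracketZl hx hy scaler0 addr0.
Qed.

Lemma centre2_submod : submod_closed centre2.
Proof.
have [z0 zP] := centre_submod.
split; first by apply/centre2P => h; rewrite sbracket0l.
move=> k x y /centre2P hx /centre2P hy; apply/centre2P => h.
by rewrite sbracketDl sbracketZl; exact: zP.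
Qed.

Lemma centre_graded x0 x1 : x0 \in homog false -> x1 \in homog true ->
  x0 + x1 \in centre -> x0 \in centre /\ x1 \in centre.
Proof.
move=> h0 h1 /centreP hc.
have key h : {[x0, h]} = 0 /\ {[x1, h]} = 0.
  have [y0 [y1 [e0 e1 ->]]] := homog_decomp h.
  have := hc y0; rewrite sbracketDl.
  move=> /(homog_add_eq0 (sbracket_homog h0 e0) (sbracket_homog h1 e0)).
  move=> [a0 a1]; have := hc y1; rewrite sbracketDl addrC.
  move=> /(homog_add_eq0 (sbracket_homog h1 e1) (sbracket_homog h0 e1)).
  by move=> [b1 b0]; rewrite !sbracketDr a0 a1 b0 b1 addr0.
by split; apply/centreP => h; have [] := key h.
Qed.

Lemma centre2_graded x0 x1 : x0 \in homog false -> x1 \in homog true ->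
  x0 + x1 \in centre2 -> x0 \in centre2 /\ x1 \in centre2.
Proof.
move=> h0 h1 /centre2P hc; have [z0 zP] := centre_submod.
have zD x y : x \in centre -> y \in centre -> x + y \in centre.
  by move=> hx hy; rewrite -[x]scale1r; exact: zP.
have key h : {[x0, h]} \in centre /\ {[x1, h]} \in centre.
  have [y0 [y1 [e0 e1 ->]]] := homog_decomp h.
  have := hc y0; rewrite sbracketDl.
  move=> /(centre_graded (sbracket_homog h0 e0) (sbracket_homog h1 e0)).
  move=> [a0 a1]; have := hc y1; rewrite sbracketDl addrC.
  move=> /(centre_graded (sbracket_homog h1 e1) (sbracket_homog h0 e1)).
  by move=> [b1 b0]; rewrite !sbracketDr; split; exact: zD.
by split; apply/centre2P => h; have [] := key h.
Qed.

Lemma centreCl x h : x \in centre -> {[h, x]} = 0.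
Proof.
have [x0 [x1 [h0 h1 ->]]] := homog_decomp x.
have [y0 [y1 [e0 e1 ->]]] := homog_decomp h.
move=> /(centre_graded h0 h1)[/centreP c0 /centreP c1].
rewrite !sbracketDl !sbracketDr.
rewrite (super_skew e0 h0) (super_skew e0 h1) (super_skew e1 h0).
by rewrite (super_skew e1 h1) !(c0, c1) !scaler0 !oppr0 !addr0.
Qed.

Lemma centre2Cl x h : x \in centre2 -> {[h, x]} \in centre.
Proof.
have [z0 zP] := centre_submod.
have zZ k y : y \in centre -> - (k *: y) \in centre.
  by move=> hy; rewrite -scaleNr -[_ *: _]addr0; exact: zP.
have zD y z : y \in centre -> z \in centre -> y + z \in centre.
  by move=> hy hz; rewrite -[y]scale1r; exact: zP.
have [x0 [x1 [h0 h1 ->]]] := homog_decomp x.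
have [y0 [y1 [e0 e1 ->]]] := homog_decomp h.
move=> /(centre2_graded h0 h1)[/centre2P c0 /centre2P c1].
rewrite !sbracketDl !sbracketDr.
rewrite (super_skew e0 h0) (super_skew e0 h1) (super_skew e1 h0).
by rewrite (super_skew e1 h1); apply: (zD); apply: (zD); apply: (zZ).
Qed.

Lemma centre_centre2 x : x \in centre -> x \in centre2.
Proof.
move=> /centreP hx; apply/centre2P => h.
by rewrite hx; have [] := centre_submod.
Qed.

Lemma centre2_absorb x y :
  x \in centre2 -> {[x, y]} \in centre2 /\ {[y, x]} \in centre2.
Proof.
move=> hx; split; apply: centre_centre2; last exact: centre2Cl.
by move/centre2P: hx; apply.
Qed.

Definition centre2_ideal : gideal H :=
  GIdeal centre2_submod centre2_absorb centre2_graded.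

End Centre.

Definition two_capable (K : fieldType) (L : lieSuperType K) : Prop :=
  exists H : lieSuperType K, lieSuper_isom L (lieQuot (centre2_ideal H)).

Section Abelian.
Variables (K : fieldType) (m n : nat).

Definition abelianSuper : Type := ('rV[K]_m * 'rV[K]_n)%type.

HB.instance Definition _ := GRing.Lmodule.on abelianSuper.

Implicit Types x y : abelianSuper.

Definition abelian_homog (a : bool) : {pred abelianSuper} :=
  [pred x | if a then x.1 == 0 else x.2 == 0].

Definition abelian_bracket x y : abelianSuper := 0.

Fact abelian_homog_submod a : submod_closed (abelian_homog a).
Proof.
by case: a; split=> [|k x y]; rewrite ?inE //= => /eqP-> /eqP->;
  rewrite scaler0 addr0.
Qed.

Fact abelian_homog_decomp x : exists x0 x1 : abelianSuper,
  [/\ x0 \in abelian_homog false, x1 \in abelian_homog true & x = x0 + x1].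
Proof.
exists (x.1, 0), (0, x.2); split; rewrite ?inE //=.
by case: x => x1 x2; congr pair; rewrite /= ?addr0 ?add0r.
Qed.

Fact abelian_homog_direct x :
  x \in abelian_homog false -> x \in abelian_homog true -> x = 0.
Proof. by case: x => x1 x2; rewrite !inE /= => /eqP-> /eqP->. Qed.

Fact abelian_bracket_linearl y : linear (abelian_bracket^~ y).
Proof. by move=> k x x'; rewrite /abelian_bracket scaler0 addr0. Qed.

Fact abelian_bracket_linearr x : linear (abelian_bracket x).
Proof. by move=> k y y'; rewrite /abelian_bracket scaler0 addr0. Qed.

Fact abelian_bracket_homog a b x y :
  x \in abelian_homog a -> y \in abelian_homog b ->
  abelian_bracket x y \in abelian_homog (a (+) b).
Proof. by move=> _ _; have [] := abelian_homog_submod (a (+) b). Qed.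

Fact abelian_super_skew a b x y :
  x \in abelian_homog a -> y \in abelian_homog b ->
  abelian_bracket x y = - ((-1) ^+ (a && b) *: abelian_bracket y x).
Proof. by move=> _ _; rewrite scaler0 oppr0. Qed.

Fact abelian_super_jacobi a b x y z :
  x \in abelian_homog a -> y \in abelian_homog b ->
  abelian_bracket x (abelian_bracket y z) =
    abelian_bracket (abelian_bracket x y) z
    + (-1) ^+ (a && b) *: abelian_bracket y (abelian_bracket x z).
Proof. by move=> _ _; rewrite scaler0 addr0. Qed.

Fact abelian_super_alt x :
  x \in abelian_homog false -> abelian_bracket x x = 0.
Proof. by []. Qed.

Fact abelian_super_cube x : x \in abelian_homog true ->
  abelian_bracket x (abelian_bracket x x) = 0.
Proof. by []. Qed.

HB.instance Definition _ := isLieSuper.Build K abelianSuper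
  abelian_homog_submod abelian_homog_decomp abelian_homog_direct
  abelian_bracket_linearl abelian_bracket_linearr abelian_bracket_homog
  abelian_super_skew abelian_super_jacobi abelian_super_alt abelian_super_cube.

End Abelian.

(* Main.v *)
Require Import Defs.
From mathcomp Require Import all_boot all_algebra.
From HB Require Import structures.
From mathcomp Require Import ring.

Set Implicit Arguments.
Unset Strict Implicit.
Unset Printing Implicit Defensive.

Import GRing.Theory.
Local Open Scope ring_scope.

(** In one direction, dimension one is excluded because a superalgebra H that
    is generated by one homogeneous x modulo Z_2(H) equals Z_2(H): the only
    bracket not already in the centre is [x, x], which is zero for x even, and
    for x odd is central because [x, [x, x]] = 0 and, by the Jacobi identity,
    [x, x] brackets Z_2(H) to zero ([cyclic_mod_centre2]).  So a 2-capable
    superalgebra spanned by one homogeneous element is zero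
    ([two_capable_cyclic]).

    In the other direction, let V have a basis of m even and n odd letters, and
    let H be the sum of V, V (x) V and V (x) V (x) V, that is, the augmentation
    ideal of the tensor superalgebra of V modulo words of length at least four,
    with the supercommutator as bracket.  Being a supercommutator it satisfies
    the alternating and cubic axioms in every characteristic.  Brackets raise
    length, so tensors without linear part lie in Z_2(H).  Conversely, if x has
    a nonzero coefficient at the letter i and j is another letter, then the word
    jii occurs in [[x, e_j], e_i], up to sign with that same coefficient; hence
    x is not in Z_2(H).  With at least two letters, Z_2(H) is therefore the part
    of length at least two ([centre2_words]) and H / Z_2(H) is V with zero
    bracket. *)

(** * Superalgebras with a cyclic quotient by the second centre *)

Section Cyclic.
Variables (K : fieldType).

(** As H is spanned by x and Z_2(H), it suffices that [x, x] be central, and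
    this is again only to be tested on x and on Z_2(H). *)
Lemma cyclic_mod_centre2 (H : lieSuperType K) (a : bool) (x : H) :
    x \in homog a -> (forall h, exists k, h - k *: x \in @centre2 K H) ->
  x \in @centre2 K H.
Proof.
move=> hx gen; have [z0 zP] := centre_submod H.
have xxC : {[x, x]} \in @centre K H.
  apply/centreP => h; have [k /centre2P hz] := gen h.
  have xz : {[x, h - k *: x]} \in @centre K H.
    by apply: centre2Cl; apply/centre2P.
  rewrite -[h](subrK (k *: x)) sbracketDr sbracketZr.
  have -> : {[{[x, x]}, x]} = 0.
    case: a hx => hx; last by rewrite super_alt ?sbracket0l.
    rewrite (super_skew (sbracket_homog hx hx) hx) super_cube //.
    by rewrite scaler0 oppr0.
  (* With z in Z_2(H), [x, z] is central, so that the Jacobi identity for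
     x, x, z leaves [[x, x], z] = 0. *)
  have := super_jacobi (h - k *: x) hx hx.
  by rewrite !(centreCl _ xz) !scaler0 !addr0.
apply/centre2P => h; have [k hz] := gen h.
rewrite -[h](subrK (k *: x)) sbracketDr sbracketZr addrC.
by apply: zP => //; exact: centre2Cl.
Qed.

(** A homogeneous lift to H of the image of e generates H modulo Z_2(H), hence
    lies in Z_2(H), and the image of e vanishes. *)
Lemma two_capable_cyclic (L : lieSuperType K) (a : bool) (e : L) :
    two_capable L -> e \in homog a -> (forall y, exists k, y = k *: e) ->
  e = 0.
Proof.
move=> [H [f [bij_f fhom _]]] he gen; apply: (bij_inj bij_f).
have /quot_homogP[x hx fe] := fhom a e he.
rewrite linear0 fe; apply/eqP; rewrite lieProj_eq0.
apply: (cyclic_mod_centre2 hx) => h.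
have [g _ gK] := bij_f; have [k gh] := gen (g (lieProj _ h)).
exists k; rewrite -[_ - _ \in _]/(_ \in gideal_mem (centre2_ideal H)).
by rewrite -lieProj_eq lieProjZ -fe -linearZ -gh gK.
Qed.

End Cyclic.

(** * The truncated tensor superalgebra *)

Section Parity.
Variables (K : fieldType) (W : finType) (q : W -> bool).
Implicit Types (a : bool) (f g : {ffun W -> K^o}).

Definition part a f : {ffun W -> K^o} := [ffun w => (q w == a)%:R * f w].

Definition supported a f := f == part a f.

(** The condition is kept as an equation, rather than as vanishing off the
    parity a, so that it can be substituted into bracket coefficients: identities
    between them then become ring identities for each choice of parities. *)
Lemma supportedP a f :
  reflect (forall w, f w = (q w == a)%:R * f w) (supported a f).
Proof.
apply: (iffP eqP) => [e w|e]; first by rewrite {1}e ffunE.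
by apply/ffunP => w; rewrite ffunE -e.
Qed.

Lemma supported0 a : supported a 0.
Proof. by apply/supportedP => w; rewrite ffunE mulr0. Qed.

Lemma supported_lin a (k : K) f g :
  supported a f -> supported a g -> supported a (k *: f + g).
Proof.
move=> /supportedP hf /supportedP hg; apply/supportedP => w.
by rewrite !ffunE mulrDr mulrCA -hf -hg.
Qed.

Lemma supported_part a f : supported a (part a f).
Proof. by apply/supportedP => w; rewrite !ffunE mulrA -natrM mulnb andbb. Qed.

Lemma part_decomp f : f = part false f + part true f.
Proof.
by apply/ffunP => w; rewrite !ffunE -mulrDl; case: (q w);
  rewrite /= ?addr0 ?add0r mul1r.
Qed.

Lemma supported_direct f : supported false f -> supported true f -> f = 0.
Proof.
move=> /supportedP h0 /supportedP h1; apply/ffunP => w; rewrite ffunE h1 h0.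
by case: (q w); rewrite !mul0r ?mulr0.
Qed.

End Parity.

(** Coefficients of words of length 1, 2 and 3 over the alphabet I.  The
    parity p of the letters is a phantom argument, since the bracket depends on it. *)
Definition words3 (K : fieldType) (I : finType) (p : I -> bool) : Type :=
  ({ffun I -> K^o} * {ffun I * I -> K^o} * {ffun I * I * I -> K^o})%type.

Section Words.
Variables (K : fieldType) (I : finType) (p : I -> bool).
Local Notation W := (words3 K p).

HB.instance Definition _ := GRing.Lmodule.on W.

Implicit Types (x y z : W) (i j k : I) (a b : bool).

Definition coef1 x i : K := x.1.1 i.
Definition coef2 x i j : K := x.1.2 (i, j).
Definition coef3 x i j k : K := x.2 (i, j, k).

Definition mk_words (f1 : I -> K) (f2 : I -> I -> K) (f3 : I -> I -> I -> K) :
    W :=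
  ([ffun i => f1 i], [ffun w => f2 w.1 w.2], [ffun w => f3 w.1.1 w.1.2 w.2]).

Lemma coef1_mk f1 f2 f3 i : coef1 (mk_words f1 f2 f3) i = f1 i.
Proof. by rewrite /coef1 ffunE. Qed.
Lemma coef2_mk f1 f2 f3 i j : coef2 (mk_words f1 f2 f3) i j = f2 i j.
Proof. by rewrite /coef2 ffunE. Qed.
Lemma coef3_mk f1 f2 f3 i j k : coef3 (mk_words f1 f2 f3) i j k = f3 i j k.
Proof. by rewrite /coef3 ffunE. Qed.
Lemma coef1_0 i : coef1 0 i = 0. Proof. by rewrite /coef1 ffunE. Qed.
Lemma coef2_0 i j : coef2 0 i j = 0. Proof. by rewrite /coef2 ffunE. Qed.
Lemma coef3_0 i j k : coef3 0 i j k = 0. Proof. by rewrite /coef3 ffunE. Qed.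
Lemma coef1D x y i : coef1 (x + y) i = coef1 x i + coef1 y i.
Proof. by rewrite /coef1 ffunE. Qed.
Lemma coef2D x y i j : coef2 (x + y) i j = coef2 x i j + coef2 y i j.
Proof. by rewrite /coef2 ffunE. Qed.
Lemma coef3D x y i j k : coef3 (x + y) i j k = coef3 x i j k + coef3 y i j k.
Proof. by rewrite /coef3 ffunE. Qed.
Lemma coef1N x i : coef1 (- x) i = - coef1 x i.
Proof. by rewrite /coef1 ffunE. Qed.
Lemma coef2N x i j : coef2 (- x) i j = - coef2 x i j.
Proof. by rewrite /coef2 ffunE. Qed.
Lemma coef3N x i j k : coef3 (- x) i j k = - coef3 x i j k.
Proof. by rewrite /coef3 ffunE. Qed.
Lemma coef1Z (c : K) x i : coef1 (c *: x) i = c * coef1 x i.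
Proof. by rewrite /coef1 ffunE. Qed.
Lemma coef2Z (c : K) x i j : coef2 (c *: x) i j = c * coef2 x i j.
Proof. by rewrite /coef2 ffunE. Qed.
Lemma coef3Z (c : K) x i j k : coef3 (c *: x) i j k = c * coef3 x i j k.
Proof. by rewrite /coef3 ffunE. Qed.

Definition coefE := (coef1_mk, coef2_mk, coef3_mk, coef1_0, coef2_0, coef3_0,
  (coef1D, coef2D, coef3D), (coef1N, coef2N, coef3N), (coef1Z, coef2Z, coef3Z)).

Lemma words3P x y :
    (forall i, coef1 x i = coef1 y i) ->
    (forall i j, coef2 x i j = coef2 y i j) ->
    (forall i j k, coef3 x i j k = coef3 y i j k) ->
  x = y.
Proof.
case: x y => [[x1 x2] x3] [[y1 y2] y3] h1 h2 h3.
congr (_, _, _); apply/ffunP.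
- exact: h1.
- by case=> i j; exact: h2.
- by case=> [[i j] k]; exact: h3.
Qed.

Definition par2 (w : I * I) := p w.1 (+) p w.2.
Definition par3 (w : I * I * I) := p w.1.1 (+) p w.1.2 (+) p w.2.

Definition words_homog a : {pred W} :=
  [pred x | [&& supported p a x.1.1, supported par2 a x.1.2
             & supported par3 a x.2]].

Lemma words_homogP a x : reflect
  [/\ forall i, coef1 x i = (p i == a)%:R * coef1 x i,
      forall i j, coef2 x i j = (p i (+) p j == a)%:R * coef2 x i j
    & forall i j k,
        coef3 x i j k = (p i (+) p j (+) p k == a)%:R * coef3 x i j k]
  (x \in words_homog a).
Proof.
rewrite inE; apply: (iffP and3P) => -[h1 h2 h3].
  split=> [i|i j|i j k].
  - exact: (supportedP _ _ _ h1 i).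
  - exact: (supportedP _ _ _ h2 (i, j)).
  - exact: (supportedP _ _ _ h3 (i, j, k)).
split; apply/supportedP.
- exact: h1.
- by case=> i j; exact: h2.
- by case=> [[i j] k]; exact: h3.
Qed.

Local Notation sg a b := ((-1) ^+ (a && b) : K).

(** The coefficient of w in the bracket is the sum over factorisations w = uv
    into nonempty words of x_u y_v - (-1)^(|u||v|) y_u x_v, where |u| is the
    parity of u.  Putting the sign on words extends the supercommutator
    bilinearly to elements that are not homogeneous. *)
Definition words_bracket x y : W := mk_words (fun=> 0)
  (fun i j => coef1 x i * coef1 y j - sg (p i) (p j) * (coef1 y i * coef1 x j))
  (fun i j k =>
     (coef1 x i * coef2 y j k + coef2 x i j * coef1 y k)
     - (sg (p i) (p j (+) p k) * (coef1 y i * coef2 x j k)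
        + sg (p i (+) p j) (p k) * (coef2 y i j * coef1 x k))).

Fact words_homog_submod a : submod_closed (words_homog a).
Proof.
split; first by rewrite inE !supported0.
by move=> c x y /and3P[? ? ?] /and3P[? ? ?]; rewrite inE !supported_lin.
Qed.

Fact words_homog_decomp x : exists x0 x1 : W,
  [/\ x0 \in words_homog false, x1 \in words_homog true & x = x0 + x1].
Proof.
pose P a : W := (part p a x.1.1, part par2 a x.1.2, part par3 a x.2).
exists (P false), (P true); split; rewrite ?inE ?supported_part //.
by case: x @P => [[x1 x2] x3] /=; congr (_, _, _); exact: part_decomp.
Qed.

Fact words_homog_direct x :
  x \in words_homog false -> x \in words_homog true -> x = 0.
Proof.
case: x => [[x1 x2] x3] /and3P[/= h1 h2 h3] /and3P[/= k1 k2 k3].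
by congr (_, _, _); apply: supported_direct; eassumption.
Qed.

Fact words_bracket_linearl y : linear (words_bracket^~ y).
Proof. by move=> c x x'; apply: words3P => *; rewrite !coefE; ring. Qed.

Fact words_bracket_linearr x : linear (words_bracket x).
Proof. by move=> c y y'; apply: words3P => *; rewrite !coefE; ring. Qed.

Fact words_bracket_homog a b x y :
  x \in words_homog a -> y \in words_homog b ->
  words_bracket x y \in words_homog (a (+) b).
Proof.
move=> /words_homogP[x1 x2 _] /words_homogP[y1 y2 _]; apply/words_homogP.
split=> [i|i j|i j k]; rewrite !coefE ?mulr0 //.
  rewrite (x1 i) (x1 j) (y1 i) (y1 j).
  by case: (p i) (p j) a b {x1 x2 y1 y2} => -[] [] [] /=; ring.
rewrite (x1 i) (x1 k) (y1 i) (y1 k) (x2 i j) (x2 j k) (y2 i j) (y2 j k).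
by case: (p i) (p j) (p k) a b {x1 x2 y1 y2} => -[] [] [] [] /=; ring.
Qed.

Fact words_super_skew a b x y :
  x \in words_homog a -> y \in words_homog b ->
  words_bracket x y = - ((-1) ^+ (a && b) *: words_bracket y x).
Proof.
move=> /words_homogP[x1 x2 _] /words_homogP[y1 y2 _].
apply: words3P => [i|i j|i j k]; rewrite !coefE; first by ring.
  rewrite (x1 i) (x1 j) (y1 i) (y1 j).
  by case: (p i) (p j) a b {x1 x2 y1 y2} => -[] [] [] /=; ring.
rewrite (x1 i) (x1 k) (y1 i) (y1 k) (x2 i j) (x2 j k) (y2 i j) (y2 j k).
by case: (p i) (p j) (p k) a b {x1 x2 y1 y2} => -[] [] [] [] /=; ring.
Qed.

(** Only linear parts reach length three in a double bracket, and homogeneity of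
    x and y turns the sign (-1)^(ab) into the signs attached to letters. *)
Fact words_super_jacobi a b x y z :
  x \in words_homog a -> y \in words_homog b ->
  words_bracket x (words_bracket y z) = words_bracket (words_bracket x y) z
    + (-1) ^+ (a && b) *: words_bracket y (words_bracket x z).
Proof.
move=> /words_homogP[x1 _ _] /words_homogP[y1 _ _].
apply: words3P => [i|i j|i j k]; rewrite !coefE; [by ring|by ring|].
rewrite (x1 i) (x1 j) (x1 k) (y1 i) (y1 j) (y1 k).
by case: (p i) (p j) (p k) a b {x1 y1} => -[] [] [] [] /=; ring.
Qed.

Fact words_super_alt x : x \in words_homog false -> words_bracket x x = 0.
Proof.
move=> /words_homogP[x1 _ _].
apply: words3P => [i|i j|i j k]; rewrite !coefE //.
  by rewrite (x1 i) (x1 j); case: (p i) (p j) => -[] /=; ring.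
by rewrite (x1 i) (x1 k); case: (p i) (p j) (p k) => -[] [] /=; ring.
Qed.

Fact words_super_cube x : x \in words_homog true ->
  words_bracket x (words_bracket x x) = 0.
Proof.
move=> /words_homogP[x1 _ _].
apply: words3P => [i|i j|i j k]; rewrite !coefE //; first by ring.
rewrite (x1 i) (x1 j) (x1 k).
by case: (p i) (p j) (p k) => -[] [] /=; ring.
Qed.

HB.instance Definition _ := isLieSuper.Build K W
  words_homog_submod words_homog_decomp words_homog_direct
  words_bracket_linearl words_bracket_linearr words_bracket_homog
  words_super_skew words_super_jacobi words_super_alt words_super_cube.

Definition letter i : W :=
  mk_words (fun j => (j == i)%:R) (fun _ _ => 0) (fun _ _ _ => 0).

(** Two letters are needed to see that x is not in Z_2: over a single letter i,
    the bracket [[x, e_i], e_i] is zero. *)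
Lemma centre2_words x : (1 < #|I|)%N ->
  (x \in @centre2 K W) <-> (forall i, coef1 x i = 0).
Proof.
move=> I2; split=> [/centre2P xZ2 i | x0].
  have [j ji] : exists j, j != i.
    have /card_gt0P[j] : (0 < #|predC1 i|)%N by rewrite cardC1 -subn1 subn_gt0.
    by exists j.
  (* Among the products of x, e_j and e_i in the double bracket, only
     (e_j x) e_i contains the word jii, since j and i differ. *)
  have /centreP/(_ (letter i))/(congr1 (fun y => coef3 y j i i)) :=
    xZ2 (letter j).
  rewrite !coefE !eqxx (negPf ji) [i == j]eq_sym (negPf ji) /= !(mulr0, mul0r).
  rewrite mulr1 add0r addr0 subr0 sub0r mul1r => /eqP.
  by rewrite oppr_eq0 mulf_eq0 signr_eq0 => /eqP.
apply/centre2P => h; apply/centreP => h'.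
by apply: words3P => *; rewrite !coefE // ?x0; ring.
Qed.

End Words.

(** * Abelian superalgebras *)

Section Abelian.
Variables (K : fieldType) (m n : nat).
Local Notation A := (abelianSuper K m n).
Local Notation I := ('I_m + 'I_n)%type.

Definition letter_parity (i : I) : bool := if i is inr _ then true else false.
Local Notation H := (words3 K letter_parity).

Definition words1 (v : A) : H := mk_words letter_parity
  (fun i => match i with inl i => v.1 0 i | inr j => v.2 0 j end)
  (fun _ _ => 0) (fun _ _ _ => 0).

Definition linear_part (x : H) : A :=
  (\row_i coef1 x (inl i), \row_j coef1 x (inr j)).

Lemma words1K : cancel words1 linear_part.
Proof. by case=> v w; congr pair; apply/rowP => i; rewrite mxE coefE. Qed.

Lemma coef1_linear_part x i : coef1 (words1 (linear_part x)) i = coef1 x i.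
Proof. by rewrite coefE; case: i => i; rewrite /= mxE. Qed.

Lemma words1_linear : linear words1.
Proof.
by move=> k u v; apply: words3P => [[i|i]|*|*];
  rewrite !coefE ?mxE ?mulr0 ?addr0.
Qed.

Lemma words1_homog a v : v \in homog a -> words1 v \in homog a.
Proof.
rewrite inE => hv; apply/words_homogP.
split=> [i|*|*]; rewrite !coefE ?mulr0 //.
by case: a hv i => /eqP hv [] i; rewrite /= ?hv ?mxE ?mulr0 ?mul1r.
Qed.

(** The isomorphism is the class of a linear combination of letters; its inverse
    reads off the linear part of any representative, which is well defined
    because Z_2 consists of the elements with zero linear part. *)
Lemma abelian_two_capable : (1 < m + n)%N -> two_capable A.
Proof.
move=> mn; have I2 : (1 < #|{: I}|)%N by rewrite card_sum !card_ord.
pose Z := centre2_ideal H.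
have Z1 (x : H) : (x \in gideal_mem Z) <-> (forall i, coef1 x i = 0).
  exact: centre2_words.
pose f (v : A) : lieQuot Z := lieProj Z (words1 v).
have f_lin : linear f.
  by move=> k u v; rewrite /f words1_linear lieProjD lieProjZ.
pose fL := GRing.isLinear.Build K A (lieQuot Z) *:%R f f_lin.
pose F : {linear A -> lieQuot Z} := HB.pack f fL.
exists H, F; split.
- exists (fun u => linear_part (lieRepr u)) => [v|u].
    have /Z1 e : lieRepr (f v) - words1 v \in gideal_mem Z.
      exact: lieRepr_proj.
    rewrite -[RHS]words1K; congr pair; apply/rowP => i; rewrite !mxE;
    by apply/eqP; rewrite -subr_eq0 -coef1N -coef1D e.
  rewrite -[RHS]lieReprK; apply/lieProjP/Z1 => i.
  by rewrite coef1D coef1N coef1_linear_part subrr.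
- move=> a v hv; apply/quot_homogP.
  by exists (words1 v); first exact: words1_homog.
move=> u v; rewrite [LHS]linear0 /=; apply/esym.
rewrite -[LHS]/(quot_bracket (f u) (f v)) quot_bracketE.
by apply/eqP; rewrite lieProj_eq0; apply/Z1 => i; rewrite coefE.
Qed.

Lemma abelian_homog_generator : (m + n = 1)%N ->
  exists a (e : A), [/\ e \in homog a, e != 0 & forall y, exists k, y = k *: e].
Proof.
(* One of the two blocks is empty, so the vector with all entries 1 is a
   homogeneous basis vector in either case. *)
move=> mn; exists (m == 0)%N, (const_mx 1, const_mx 1); split.
- rewrite inE; case: m n mn => [|[|//]] [|[|//]] //= _;
    by apply/eqP/rowP; case.
- apply/eqP => e0; have v0 : const_mx 1 = 0 :> 'rV[K]_m := congr1 fst e0.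
  have w0 : const_mx 1 = 0 :> 'rV[K]_n := congr1 snd e0.
  have [m0|m0] := posnP m.
    have n0 : (0 < n)%N by rewrite -[n]add0n -[X in (X + n)%N]m0 mn.
    by have /rowP/(_ (Ordinal n0))/eqP := w0; rewrite !mxE oner_eq0.
  by have /rowP/(_ (Ordinal m0))/eqP := v0; rewrite !mxE oner_eq0.
case: m n mn => [|[|//]] [|[|//]] //= _ [v w].
  exists (w 0 0); congr pair; apply/rowP => i; rewrite !mxE; first by case: i.
  by rewrite mulr1 ord1.
exists (v 0 0); congr pair; apply/rowP => i; rewrite !mxE; last by case: i.
by rewrite mulr1 ord1.
Qed.

End Abelian.

Theorem theorem6p9 (K : fieldType) (m n : nat) (hL : (0 < m + n)%N) :
  two_capable (abelianSuper K m n) <-> (2 <= m + n)%N.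
Proof.
split; last exact: abelian_two_capable.
move=> cap; rewrite ltn_neqAle hL andbT; apply/eqP => /esym mn1.
have [a [e [he e0 gen]]] := abelian_homog_generator K mn1.
by move/eqP: e0; apply; exact: two_capable_cyclic cap he gen.
Qed.
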